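(* Let $P_0,P_1$ be two probability distributions on a measurable space, let $\epsilon\in[0,1]$, and assume $\mathsf{TV}(P_0,P_1)>2\epsilon$. Let $X_1,\dots,X_n$ be i.i.d. observations and let $\phi=\phi(X_1,\dots,X_n)$ be the test $$\phi=\mathbb{I}\left\{|P_n(A)-P_0(A)|>|P_n(A)-P_1(A)|\right\},\qquad A=\{p_0>p_1\},$$ where $P_n(A)=\frac1n\sum_{i=1}^n\mathbb{I}\{X_i\in A\}$ and $p_j=\frac{dP_j}{d(P_0+P_1)}$ for $j=0,1$. Then $$\sup_{P\in\{(1-\epsilon)P_0+\epsilon Q:\,Q\}}P\phi+\sup_{P\in\{(1-\epsilon)P_1+\epsilon Q:\,Q\}}P(1-\phi)\leq 4\exp\left(-\frac{1}{2}n\left(\mathsf{TV}(P_0,P_1)-2\epsilon\right)^2\right),$$ where in both suprema $Q$ ranges over all probability distributions on the same measurable space.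
   Context: $\mathsf{TV}(P_0,P_1)=\sup_B|P_0(B)-P_1(B)|$ is the total variation distance (supremum over measurable sets). $\mathbb{I}$ denotes an indicator function. The set $A=\{p_0>p_1\}$ maximizes $|P_0(B)-P_1(B)|$ over measurable $B$. For a function $g$ of the data, $Pg$ denotes the expectation of $g(X_1,\dots,X_n)$ when $X_1,\dots,X_n$ are i.i.d. from $P$. *)

(* Defs.v *)
From HB Require Import structures.
From mathcomp Require Import all_boot all_order all_algebra.
From mathcomp Require Import all_classical all_reals all_analysis.
From mathcomp Require Import measurable_realfun.

Set Implicit Arguments.
Unset Strict Implicit.
Unset Printing Implicit Defensive.

Import Order.TTheory GRing.Theory Num.Theory.

Local Open Scope classical_set_scope.
Local Open Scope ring_scope.
Local Open Scope charge_scope.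

Section dominating_measure.
Context d (T : measurableType d) (R : realType) (P0 P1 : probability T R).

Definition prob_sum : set T -> \bar R := measure_add P0 P1.

HB.instance Definition _ := Measure.on prob_sum.

Let prob_sum_fin : fin_num_fun prob_sum.
Proof.
by move=> B mB; rewrite /prob_sum measure_addE fin_numD !fin_num_measure.
Qed.

HB.instance Definition _ := Measure_isFinite.Build _ _ _ prob_sum prob_sum_fin.

End dominating_measure.

(* Radon-Nikodym derivatives are only determined almost everywhere: f is any
   measurable version of dnu/dmu, not just the one selected by the library. *)
Definition RN_version d (T : measurableType d) (R : realType)
    (nu : {finite_measure set T -> \bar R})
    (mu : {sigma_finite_measure set T -> \bar R}) (f : T -> \bar R) : Prop :=
  measurable_fun [set: T] f /\
  ae_eq mu [set: T] f ('d (charge_of_finite_measure nu) '/d mu).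

Definition TV d (T : measurableType d) (R : realType)
    (P0 P1 : probability T R) : R :=
  sup [set `|fine (P0 B) - fine (P1 B)| | B in measurable].

(* P = (1 - eps) P0 + eps Q is required on measurable sets only, since the
   values of a library measure outside the sigma-algebra are irrelevant. *)
Definition contamination d (T : measurableType d) (R : realType) (eps : R)
    (P0 : probability T R) : set (probability T R) :=
  [set P | exists Q : probability T R, forall B, measurable B ->
    P B = ((1 - eps)%:E * P0 B + eps%:E * Q B)%E].

Lemma contamination_mixture d (T : measurableType d) (R : realType) (eps : R)
    (P0 Q : probability T R) : 0 <= eps <= 1 ->
  exists P : probability T R, forall B, measurable B ->
    P B = ((1 - eps)%:E * P0 B + eps%:E * Q B)%E.
Proof.
move=> /andP[e0 e1]; have e1' : 0 <= 1 - eps by rewrite subr_ge0.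
pose m : {measure set T -> \bar R} :=
  measure_add (mscale (NngNum e1') P0) (mscale (NngNum e0) Q).
have mE B : m B = ((1 - eps)%:E * P0 B + eps%:E * Q B)%E.
  exact: measure_addE.
have mT : m setT = 1%E.
  by rewrite mE !probability_setT !mule1 -EFinD subrK.
exists (mnormalize m Q) => B mB.
transitivity (mnormalize m Q B) => //.
by rewrite /mnormalize mT onee_eq0/= invr1 mule1 mE.
Qed.

Section iid.
Context d (T : measurableType d) (R : realType).

Definition cons_pair n (x : T * n.-tuple T) : n.+1.-tuple T :=
  [the n.+1.-tuple T of x.1 :: x.2].

Lemma measurable_cons_pair n : measurable_fun [set: T * n.-tuple T]
  (@cons_pair n).
Proof. by apply: measurable_cons. Qed.

HB.instance Definition _ n :=
  isMeasurableFun.Build _ _ _ _ (@cons_pair n) (@measurable_cons_pair n).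

(* The n-fold product measure, i.e. the joint law of n i.i.d. observations
   from P; see iidE. *)
Fixpoint iid (P : probability T R) n : probability (n.-tuple T) R :=
  match n with
  | 0 => \d_([tuple] : 0.-tuple T)
  | n'.+1 => distribution (P \x iid P n')%E (@cons_pair n')
  end.

Lemma iidE (P : probability T R) n (A : 'I_n -> set T) :
  (forall i, measurable (A i)) ->
  iid P n [set x | forall i, A i (tnth x i)] = (\prod_(i < n) P (A i))%E.
Proof.
elim: n A => [|n IH] A mA.
  by rewrite big_ord0 /= diracE mem_set// => -[].
rewrite big_ord_recl -IH// -product_measure1E//.
- congr (product_measure1 _ _ _); apply/seteqP; split => -[x xs] /=.
    move=> Axs; split=> [|i]; first by have := Axs ord0.
    by have := Axs (lift ord0 i); rewrite tnthS.
  move=> [Ax Axs] i; case: (unliftP ord0 i) => [j|] ->//.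
  by rewrite tnthS.
- have -> : [set x : n.-tuple T | forall i, A (lift ord0 i) (tnth x i)] =
      \bigcap_(i in [set: 'I_n]) ((fun x => tnth x i) @^-1` A (lift ord0 i)).
    by apply/seteqP; split=> x /= Ax i; [move=> _|]; exact: Ax.
  apply: fin_bigcap_measurable => // i _.
  by rewrite -[X in measurable X]setTI; exact: measurable_tnth.
Qed.

End iid.

Definition empirical d (T : measurableType d) (R : realType) n
    (x : n.-tuple T) (A : set T) : R :=
  n%:R^-1 * \sum_(i < n) \1_A (tnth x i).

Definition TV_test d (T : measurableType d) (R : realType)
    (P0 P1 : probability T R) (A : set T) n : n.-tuple T -> R :=
  \1_[set x | `|empirical R x A - fine (P0 A)| >
              `|empirical R x A - fine (P1 A)|].

(* Main.v *)
Require Import Defs.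
From HB Require Import structures.
From mathcomp Require Import all_boot all_order all_algebra.
From mathcomp Require Import all_classical all_reals all_analysis.
From mathcomp Require Import measurable_realfun.
From mathcomp Require Import ring lra.

Set Implicit Arguments.
Unset Strict Implicit.
Unset Printing Implicit Defensive.

Import Order.TTheory GRing.Theory Num.Theory.
Import numFieldNormedType.Exports.

Local Open Scope classical_set_scope.
Local Open Scope ring_scope.

(** The reason for the bound is that both suprema reduce to the deviation of a
    binomial frequency from its mean.  Write a = P0(A), b = P1(A).

    The likelihood set A attains the total variation distance
    ([TV_likelihood_set]): p0 <= p1 off A and p1 < p0 on A, so that removing
    from a set B its part outside A, then adding the part of A that B misses,
    can only increase P0(B) - P1(B); the opposite sign follows by passing to
    complements.  Hence a - b = TV > 2 eps, in particular b < a, and the test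
    rejects P0 exactly when the empirical frequency of A lies below the
    midpoint (a + b) / 2 ([closer_to_smaller]).

    Under P = (1 - eps) P0 + eps Q the true frequency P(A) is within eps of a
    ([contamination_dist]), so an error requires the empirical frequency to fall
    below its mean by at least (a - b) / 2 - eps = (TV - 2 eps) / 2 =: u; the
    same holds, upwards, under a contamination of P1.  Hoeffding's inequality
    ([hoeffding_empirical_ge], [hoeffding_empirical_le]) bounds each of these
    probabilities, uniformly in Q, by exp(- 2 n u^2), which is
    exp(- n (TV - 2 eps)^2 / 2).

    Hoeffding's inequality itself is the exponential moment method: the
    integral of a product over an i.i.d. sample factorizes
    ([iid_integral_prod]), and the moment generating function of an indicator
    is sub-Gaussian with variance proxy 1/4 ([bernoulli_mgf_le]). *)

(** * The moment generating function of a Bernoulli variable *)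

Lemma is_derive_ge0_le (R : realType) (f f' : R -> R) (s : R) : 0 <= s ->
  (forall x : R, is_derive x 1 f (f' x)) ->
  (forall x, 0 <= x -> 0 <= f' x) -> f 0 <= f s.
Proof.
move=> s0 df f'0.
apply: (@ger0_derive1_le_cc _ f 0 s) => //.
- by move=> x; rewrite in_itv/= => /andP[x0 _]; rewrite derive1E derive_val f'0// ltW.
- by apply: derivable_within_continuous => x _; exact: ex_derive.
- by rewrite in_itv/= lexx.
- by rewrite in_itv/= lexx andbT.
Qed.

(** Hoeffding's lemma for a Bernoulli variable: with D = 1 - p + p e^x, the
    logarithmic derivative of D is a Bernoulli mean q = p e^x / D under the
    tilted law; its own derivative q (1 - q) is at most 1/4.  So q <= p + x / 4
    for x >= 0, and integrating once more gives log D <= p x + x^2 / 8. *)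
Lemma bernoulli_mgf_le (R : realType) (p s : R) : 0 <= p <= 1 -> 0 <= s ->
  1 - p + p * expR s <= expR (p * s + s ^+ 2 / 8).
Proof.
move=> /andP[p0 p1] s0.
pose D (x : R) := 1 - p + p * expR x.
have D0 x : 0 < D x by rewrite /D; have := expR_gt0 x; nra.
pose h (x : R) := p + x / 4 - p * expR x * (D x)^-1.
have dD (x : R) : is_derive x 1 D (p * expR x).
  by rewrite /D; apply: is_derive_eq; rewrite /GRing.scale/=; ring.
have dh (x : R) : is_derive x 1 h (4^-1 - p * expR x * (1 - p) / D x ^+ 2).
  rewrite /h; have Dx := D0 x.
  have ? : D x != 0 by rewrite gt_eqF.
  apply: is_derive_eq; rewrite /GRing.scale/= /D; field.
  by rewrite -/(D x) gt_eqF.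
have h0 x : 0 <= x -> 0 <= h x.
  move=> x0; have -> : 0 = h 0 by rewrite /h /D expR0 !mulr1 subrK; field.
  apply: is_derive_ge0_le dh _ => // {x x0} x _; have Dx := D0 x.
  rewrite subr_ge0 ler_pdivrMr ?exprn_gt0//.
  (* q (1 - q) <= 1/4, with denominators cleared *)
  have := sqr_ge0 (1 - p - p * expR x); rewrite /D; lra.
(* D e^(- (p x + x^2/8)) is nonincreasing; the sign is changed so that the same
   monotonicity lemma applies. *)
pose g (x : R) := - (D x * expR (- (p * x + x ^+ 2 / 8))).
have dg (x : R) :
    is_derive x 1 g (D x * h x * expR (- (p * x + x ^+ 2 / 8))).
  rewrite /g; apply: is_derive_eq; rewrite /h /GRing.scale/=; field.
  by rewrite gt_eqF.
have : g 0 <= g s.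
  apply: is_derive_ge0_le dg _ => // x x0.
  by rewrite !mulr_ge0 ?expR_ge0 ?h0// ltW.
rewrite /g /D expR0 expr0n/= mul0r mulr0 addr0 oppr0 expR0 !mulr1 subrK lerN2.
by rewrite expRN ler_pdivrMr ?expR_gt0// mul1r.
Qed.

(** * Hoeffding's inequality for empirical frequencies *)

(** Independence in the form needed for exponential moments: by Tonelli, the
    first coordinate splits off the product, and one inducts on the sample
    size. *)
Lemma iid_integral_prod d (T : measurableType d) (R : realType)
    (P : probability T R) (f : T -> R) n :
  measurable_fun setT f -> (forall x, 0 <= f x) ->
  (\int[iid P n]_x (\prod_(i < n) f (tnth x i))%:E
   = (\int[P]_x (f x)%:E) ^+ n)%E.
Proof.
move=> mf f0.
have mprod m : measurable_fun setT
    (fun x : m.-tuple T => (\prod_(i < m) f (tnth x i))%:E).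
  apply/measurable_EFinP/measurable_prod => i _.
  by apply: measurableT_comp mf _; exact: measurable_tnth.
have prod0 m (x : m.-tuple T) : (0 <= (\prod_(i < m) f (tnth x i))%:E)%E.
  by rewrite lee_fin prodr_ge0.
elim: n => [|n IH].
  rewrite /= integral_dirac//; last exact: mprod.
  by rewrite big_ord0 mule1; exact: diracT.
rewrite [iid P n.+1]/= ge0_integral_distribution; last 2 first.
- exact: mprod.
- exact: prod0.
rewrite expeS -IH.
under eq_integral.
  move=> x _; rewrite /= big_ord_recl tnth0.
  under eq_bigr do rewrite tnthS.
  over.
rewrite fubini_tonelli1/=; last 2 first.
- apply/measurable_EFinP/measurable_funM.
  + exact: measurableT_comp mf measurable_fst.
  + by have /measurable_EFinP/measurableT_comp := mprod n; apply.
- by move=> x; rewrite lee_fin mulr_ge0 ?prodr_ge0.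
rewrite /fubini_F/=.
transitivity (\int[P]_x ((f x)%:E *
    \int[iid P n]_y (\prod_(i < n) f (tnth y i))%:E))%E.
  apply: eq_integral => x _; under eq_integral do rewrite EFinM.
  apply: ge0_integralZl => //.
  - exact: mprod.
  - by move=> y _; exact: prod0.
  - by rewrite lee_fin.
apply: ge0_integralZr => //.
- exact/measurable_EFinP.
- by move=> x _; rewrite lee_fin.
- by apply: integral_ge0 => y _; exact: prod0.
Qed.

Lemma measurable_empirical d (T : measurableType d) (R : realType) n
    (A : set T) : measurable A ->
  measurable_fun setT (fun x : n.-tuple T => empirical R x A).
Proof.
move=> mA; apply: measurable_funM => //; apply: measurable_sum => i.
apply: measurableT_comp; last exact: measurable_tnth.
exact: measurable_indic.
Qed.

Lemma probability_fine_itv d (T : measurableType d) (R : realType)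
    (P : probability T R) (A : set T) : measurable A -> 0 <= fine (P A) <= 1.
Proof.
move=> mA; rewrite fine_ge0//= -lee_fin fineK ?fin_num_measure//.
exact: probability_le1.
Qed.

Lemma empiricalC d (T : measurableType d) (R : realType) n (x : n.-tuple T)
    (A : set T) : (0 < n)%N ->
  empirical R x (~` A) = 1 - empirical R x A.
Proof.
move=> n0; have n0' : n%:R != 0 :> R by rewrite pnatr_eq0 -lt0n.
rewrite /empirical.
have -> : \sum_(i < n) \1_(~` A) (tnth x i) =
          n%:R - \sum_(i < n) \1_A (tnth x i) :> R.
  rewrite -[in n%:R](card_ord n) -sumr_const -sumrB.
  apply: eq_bigr => i _; rewrite indicC indicE.
  by case: (_ \in _); rewrite ?subrr ?subr0.
by rewrite mulrBr mulVf.
Qed.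

Lemma integral_expR_indic d (T : measurableType d) (R : realType)
    (P : probability T R) (A : set T) (s : R) : measurable A -> 0 <= s ->
  (\int[P]_x (expR (s * \1_A x))%:E)%E
  = (1 - fine (P A) + fine (P A) * expR s)%:E.
Proof.
move=> mA s0.
under eq_integral.
  move=> x _.
  rewrite (_ : expR _ = 1 + (expR s - 1) * \1_A x); last first.
    rewrite indicE; case: (_ \in _) => /=.
      by rewrite !mulr1; ring.
    by rewrite !mulr0 expR0 addr0.
  rewrite EFinD EFinM; over.
have s1 : 0 <= expR s - 1 by rewrite subr_ge0 -expR0 ler_expR.
rewrite ge0_integralD//=; last 2 first.
- by move=> x _; rewrite lee_fin mulr_ge0.
- by apply/measurable_EFinP/measurable_funM => //; exact: measurable_indic.
rewrite ge0_integralZl//; last first.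
- by apply/measurable_EFinP; exact: measurable_indic.
transitivity (1 + (expR s - 1)%:E * P A)%E.
  rewrite integral_cst// mul1e integral_indic// setIT.
  by congr (_ + _)%E; exact: probability_setT.
rewrite -[in LHS](@fineK _ (P A)) ?fin_num_measure//.
by rewrite -EFinM -EFinD; congr EFin; ring.
Qed.

(** Chernoff's method: the indicator of the deviation event is dominated by
    exp(s n (empirical frequency - p - u)), whose integral factorizes into
    the n-th power of a Bernoulli moment generating function. *)
Lemma hoeffding_empirical_ge d (T : measurableType d) (R : realType)
    (P : probability T R) (A : set T) n (u : R) :
  measurable A -> (0 < n)%N -> 0 <= u ->
  (iid P n [set x | (fine (P A) + u <= empirical R x A)%R]
   <= (expR (- (2 * n%:R * u ^+ 2)))%:E)%E.
Proof.
move=> mA n0 u0; set C := [set x | _]; set p := fine (P A).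
have n0' : 0 < n%:R :> R by rewrite ltr0n.
(* s = 4 u minimizes the exponent n (- s u + s^2 / 8) left at the end. *)
pose s := 4 * u; have s0 : 0 <= s by rewrite mulr_ge0.
have mC : measurable C.
  rewrite -[C]setTI; apply: measurable_fun_ler => //.
  exact: measurable_empirical.
pose c := expR (- (n%:R * s * (p + u))).
pose F (x : n.-tuple T) := \prod_(i < n) expR (s * \1_A (tnth x i)).
have mexp : measurable_fun setT (fun x : T => expR (s * \1_A x)).
  by apply: (measurableT_comp (@measurable_expR R)); apply: measurable_funM => //.
have F0 x : 0 <= F x by rewrite prodr_ge0// => i _; exact: expR_ge0.
have mF : measurable_fun setT F.
  apply: measurable_prod => i _.
  by apply: measurableT_comp mexp _; exact: measurable_tnth.
have -> : iid P n C = (\int[iid P n]_x (\1_C x)%:E)%E.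
  by rewrite integral_indic// setIT.
apply: (@le_trans _ _ (\int[iid P n]_x (c%:E * (F x)%:E))%E).
  apply: ge0_le_integral => //.
  - by apply/measurable_EFinP; exact: measurable_indic.
  - by apply/measurable_EFinP; exact: measurable_funM.
  move=> x _; rewrite -EFinM lee_fin /c /F -expR_sum -expRD -mulr_sumr.
  rewrite indicE; case: (boolP (x \in C)) => [|_]; last exact: expR_ge0.
  rewrite inE /C/= => xC; rewrite -[1%:R]expR0 ler_expR.
  have -> : \sum_(i < n) \1_A (tnth x i) = n%:R * empirical R x A.
    by rewrite /empirical mulVKf// gt_eqF.
  rewrite addrC subr_ge0 -mulrA mulrCA !ler_wpM2l// ltW.
rewrite ge0_integralZl//; last 3 first.
- exact/measurable_EFinP.
- by move=> x _; rewrite lee_fin.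
- by rewrite lee_fin expR_ge0.
rewrite (iid_integral_prod P n mexp); last by move=> x; exact: expR_ge0.
rewrite integral_expR_indic// -EFin_expe -EFinM lee_fin.
have := bernoulli_mgf_le (probability_fine_itv P mA) s0; rewrite -/p => mgf.
have [p0 p1] := andP (probability_fine_itv P mA).
apply: (@le_trans _ _ (c * expR (p * s + s ^+ 2 / 8) ^+ n)).
  rewrite ler_wpM2l ?expR_ge0// lerXn2r// nnegrE ?expR_ge0//.
  by rewrite addr_ge0 ?subr_ge0// mulr_ge0 ?expR_ge0.
rewrite -expRM_natl -expRD ler_expR /s; lra.
Qed.

(** The lower tail for A is the upper tail for its complement. *)
Lemma hoeffding_empirical_le d (T : measurableType d) (R : realType)
    (P : probability T R) (A : set T) n (u : R) :
  measurable A -> (0 < n)%N -> 0 <= u ->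
  (iid P n [set x | (empirical R x A <= fine (P A) - u)%R]
   <= (expR (- (2 * n%:R * u ^+ 2)))%:E)%E.
Proof.
move=> mA n0 u0.
have := hoeffding_empirical_ge P (measurableC mA) n0 u0.
rewrite probability_setC// fineB ?fin_num_measure//=.
congr (iid P n _ <= _)%E; apply/seteqP; split=> x /=; rewrite empiricalC//; lra.
Qed.

(** * The likelihood set attains the total variation distance *)

Lemma RN_version_integrable d (T : measurableType d) (R : realType)
    (nu : {finite_measure set T -> \bar R})
    (mu : {sigma_finite_measure set T -> \bar R}) (f : T -> \bar R) :
  charge_of_finite_measure nu `<< mu -> RN_version nu mu f ->
  mu.-integrable setT f.
Proof.
move=> numu [mf fE].
have /integrableP[mD iD] := Radon_Nikodym_integrable numu.
apply/integrableP; split => //.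
rewrite (ae_eq_integral (abse \o Radon_Nikodym (charge_of_finite_measure nu) mu))//.
- exact: measurableT_comp.
- exact: measurableT_comp.
- exact: ae_eq_abse.
Qed.

Lemma RN_version_integral d (T : measurableType d) (R : realType)
    (nu : {finite_measure set T -> \bar R})
    (mu : {sigma_finite_measure set T -> \bar R}) (f : T -> \bar R) B :
  charge_of_finite_measure nu `<< mu -> RN_version nu mu f -> measurable B ->
  nu B = (\int[mu]_(x in B) f x)%E.
Proof.
move=> numu [mf fE] mB.
have /integrableP[mD _] := Radon_Nikodym_integrable numu.
rewrite (ae_eq_integral (Radon_Nikodym (charge_of_finite_measure nu) mu))//.
- exact: (Radon_Nikodym_integral numu mB).
- exact: measurable_funS mf.
- exact: measurable_funS mD.
- exact: ae_eq_subset fE.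
Qed.

(** Integrability makes this comparison available although a version of the
    derivative may be negative or infinite on a null set. *)
Lemma RN_version_le d (T : measurableType d) (R : realType)
    (nu1 nu2 : {finite_measure set T -> \bar R})
    (mu : {sigma_finite_measure set T -> \bar R}) (f1 f2 : T -> \bar R) B :
  charge_of_finite_measure nu1 `<< mu -> charge_of_finite_measure nu2 `<< mu ->
  RN_version nu1 mu f1 -> RN_version nu2 mu f2 -> measurable B ->
  (forall x, B x -> (f1 x <= f2 x)%E) -> (nu1 B <= nu2 B)%E.
Proof.
move=> dom1 dom2 rn1 rn2 mB f12.
rewrite (RN_version_integral dom1 rn1 mB) (RN_version_integral dom2 rn2 mB).
apply: le_integral => //.
- exact: integrableS (RN_version_integrable dom1 rn1).
- exact: integrableS (RN_version_integrable dom2 rn2).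
- by move=> x; rewrite inE => /f12.
Qed.

Lemma dominates_prob_sum d (T : measurableType d) (R : realType)
    (P0 P1 : probability T R) :
  charge_of_finite_measure P0 `<< prob_sum P0 P1 /\
  charge_of_finite_measure P1 `<< prob_sum P0 P1.
Proof.
split; apply/null_content_dominatesP => B mB
  /(etrans (esym (measure_addE P0 P1 B)))/eqP;
  by rewrite padde_eq0// => /andP[/eqP P0B /eqP P1B].
Qed.

(** A Hahn decomposition of P0 - P1 attains the total variation distance: for
    any B, the difference loses a nonnegative amount on the part of A that B
    misses, and gains a nonpositive amount on B outside A. *)
Lemma TV_eq_of_sign d (T : measurableType d) (R : realType)
    (P0 P1 : probability T R) (A : set T) : measurable A ->
  (forall B, measurable B -> B `<=` A -> (P1 B <= P0 B)%E) ->
  (forall B, measurable B -> B `<=` ~` A -> (P0 B <= P1 B)%E) ->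
  TV P0 P1 = fine (P0 A) - fine (P1 A).
Proof.
move=> mA PA PAC; pose a (P : probability T R) B := fine (P B).
have aI P B C : measurable B -> measurable C ->
    a P B = a P (B `&` C) + a P (B `\` C).
  move=> mB mC; rewrite /a addrC -fineD ?fin_num_measure//; last 2 first.
  - exact: measurableD.
  - exact: measurableI.
  by congr fine; rewrite -measureDI.
have aA B : measurable B -> B `<=` A -> a P1 B <= a P0 B.
  by move=> mB BA; rewrite fine_le ?fin_num_measure// PA.
have aAC B : measurable B -> B `<=` ~` A -> a P0 B <= a P1 B.
  by move=> mB BA; rewrite fine_le ?fin_num_measure// PAC.
have up B : measurable B -> a P0 B - a P1 B <= a P0 A - a P1 A.
  move=> mB; rewrite (aI P0 B A)// (aI P1 B A)// (aI P0 A B)// (aI P1 A B)//.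
  rewrite (setIC A B).
  have := aAC (B `\` A) (measurableD mB mA) (@subDsetr _ _ _).
  have := aA (A `\` B) (measurableD mA mB) (@subDsetl _ _ _).
  lra.
have aC P B : measurable B -> a P (~` B) = 1 - a P B.
  by move=> mB; rewrite /a probability_setC// fineB ?fin_num_measure.
(* The lower bound is the upper bound for the complement of B. *)
have ub B : measurable B -> `|a P0 B - a P1 B| <= a P0 A - a P1 A.
  move=> mB; rewrite ler_norml up// andbT.
  by have := up _ (measurableC mB); rewrite !aC//; lra.
apply/eqP; rewrite eq_le; apply/andP; split.
  apply: ge_sup; first by exists `|a P0 A - a P1 A|, A.
  by move=> _ [B mB <-]; exact: ub.
apply: (le_trans (ler_norm _)); apply: ub_le_sup; last by exists A.
by exists (a P0 A - a P1 A) => _ [B mB <-]; exact: ub.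
Qed.

Lemma TV_likelihood_set d (T : measurableType d) (R : realType)
    (P0 P1 : probability T R) (p0 p1 : T -> \bar R) :
  RN_version P0 (prob_sum P0 P1) p0 -> RN_version P1 (prob_sum P0 P1) p1 ->
  let A := [set x | (p1 x < p0 x)%E] in
  measurable A /\ TV P0 P1 = fine (P0 A) - fine (P1 A).
Proof.
move=> rn0 rn1 A; have [dom0 dom1] := dominates_prob_sum P0 P1.
have mA : measurable A.
  by rewrite -[A]setTI; apply: measurable_lte => //; [exact: rn1.1|exact: rn0.1].
split=> //; apply: TV_eq_of_sign => // B mB BA.
- by apply: (RN_version_le dom1 dom0 rn1 rn0 mB) => x /BA /ltW.
- apply: (RN_version_le dom0 dom1 rn0 rn1 mB) => x /BA /negP.
  by rewrite -leNgt.
Qed.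

(** * The test under contamination *)

(** P(A) - P0(A) = eps (Q(A) - P0(A)), and Q(A), P0(A) both lie in [0, 1]. *)
Lemma contamination_dist d (T : measurableType d) (R : realType) (eps : R)
    (P0 P : probability T R) (A : set T) : 0 <= eps <= 1 ->
  contamination eps P0 P -> measurable A ->
  `|fine (P A) - fine (P0 A)| <= eps.
Proof.
move=> /andP[e0 e1] [Q PE] mA; rewrite PE// fineD ?fin_numM ?fin_num_measure//.
rewrite !fineM ?fin_num_measure//=.
have /andP[p0 p1] := probability_fine_itv P0 mA.
have /andP[q0 q1] := probability_fine_itv Q mA.
rewrite ler_norml; apply/andP; split; nra.
Qed.

Lemma closer_to_smaller (R : realFieldType) (a b s : R) : b < a ->
  (`|s - b| < `|s - a|) = (s < (a + b) / 2).
Proof.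
move=> ba; rewrite -ltr_sqr ?qualifE/= ?normr_ge0// !real_normK ?num_real//.
by apply/idP/idP; nra.
Qed.

Theorem theorem2p1 (d : measure_display) (T : measurableType d) (R : realType)
    (P0 P1 : probability T R) (eps : R) (n : nat) (p0 p1 : T -> \bar R)
    (heps : 0 <= eps <= 1) (hn : (0 < n)%N)
    (hp0 : RN_version P0 (prob_sum P0 P1) p0)
    (hp1 : RN_version P1 (prob_sum P0 P1) p1)
    (hTV : 2 * eps < TV P0 P1) :
  let A := [set x | (p1 x < p0 x)%E] in
  let phi := TV_test P0 P1 A (n := n) in
  (ereal_sup [set 'E_(iid P n)[phi] | P in contamination eps P0] +
   ereal_sup [set 'E_(iid P n)[fun x => (1 - phi x)%R]
             | P in contamination eps P1] <=
   (4 * expR (- (1 / 2) * n%:R * (TV P0 P1 - 2 * eps) ^+ 2))%:E)%E.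
Proof.
cbv zeta; set A := [set x | _]; set phi := TV_test _ _ _ (n:=n).
have [mA TVE] : measurable A /\ TV P0 P1 = fine (P0 A) - fine (P1 A).
  exact: TV_likelihood_set hp0 hp1.
set a := fine (P0 A) in TVE; set b := fine (P1 A) in TVE.
have /andP[e0 _] := heps.
have ba : b < a by rewrite -subr_gt0 -TVE (le_lt_trans _ hTV)// mulr_ge0.
pose u := (TV P0 P1 - 2 * eps) / 2.
have u0 : 0 <= u by rewrite divr_ge0// subr_ge0 ltW.
set M := expR (- (1 / 2) * _ * _).
have ME : M = expR (- (2 * n%:R * u ^+ 2)).
  by congr expR; rewrite /u; field.
have mle (c : R) : measurable [set x : n.-tuple T | empirical R x A <= c].
  rewrite -[X in measurable X]setTI; apply: measurable_fun_ler => //.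
  exact: measurable_empirical.
have mge (c : R) : measurable [set x : n.-tuple T | c <= empirical R x A].
  rewrite -[X in measurable X]setTI; apply: measurable_fun_ler => //.
  exact: measurable_empirical.
pose S := [set x : n.-tuple T | empirical R x A < (a + b) / 2].
have mS : measurable S.
  rewrite -[X in measurable X]setTI; apply: measurable_fun_ltr => //.
  exact: measurable_empirical.
have phiE : phi = \1_S.
  rewrite /phi /TV_test; congr indic.
  by apply/seteqP; split=> x /=; rewrite closer_to_smaller.
have phiCE : (fun x => 1 - phi x) = \1_(~` S).
  apply/funext => x; rewrite phiE indicC indicE.
  by case: (_ \in _); rewrite ?subrr ?subr0.
have type1 : (ereal_sup [set 'E_(iid P n)[phi] | P in contamination eps P0]
              <= M%:E)%E.
  apply: ge_ereal_sup => _ [P PP0 <-]; rewrite phiE expectation_indic//.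
  have := contamination_dist heps PP0 mA.
  rewrite ler_norml -/a => /andP[Pa _].
  rewrite ME; apply: le_trans (hoeffding_empirical_le P mA hn u0).
  apply: le_measure; rewrite ?inE; [exact: mS|exact: mle|].
  by move=> x; rewrite /S/= /u TVE; lra.
have type2 : (ereal_sup [set 'E_(iid P n)[fun x => (1 - phi x)%R]
              | P in contamination eps P1] <= M%:E)%E.
  apply: ge_ereal_sup => _ [P PP1 <-].
  rewrite phiCE expectation_indic; last exact: measurableC.
  have := contamination_dist heps PP1 mA.
  rewrite ler_norml -/b => /andP[_ Pb].
  rewrite ME; apply: le_trans (hoeffding_empirical_ge P mA hn u0).
  apply: le_measure; rewrite ?inE; [exact: measurableC|exact: mge|].
  by move=> x /negP; rewrite /S/= -leNgt /u TVE; lra.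
apply: le_trans (leeD type1 type2) _; rewrite -EFinD lee_fin.
by have := expR_ge0 (- (1 / 2) * n%:R * (TV P0 P1 - 2 * eps) ^+ 2); rewrite -/M; lra.
Qed.
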